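(* Let $E$ be an equivalence relation on a Polish space $X$. Then $E$ is non-uniformly learnable if and only if $E$ is non-uniformly BC-learnable.
   Context: $\omega$ carries the discrete topology. $E$ is non-uniformly learnable if for every $\vec x=(x_i)_{i\in\omega}\in X^\omega$ there are continuous functions $l_n(\vec x,\cdot):X\to\omega$ ($n\in\omega$) such that for every $x\in X$, if $x\mathrel{E}x_i$ for some $i$, then $L(x,\vec x)=\lim_n l_n(\vec x,x)$ exists and $x\mathrel{E}x_{L(x,\vec x)}$. $E$ is non-uniformly BC-learnable if there are continuous functions $l_n:X^\omega\times X\to\omega$ such that for all $x\in X$ and $\vec x\in X^\omega$, if $x\mathrel{E}x_i$ for some $i$, then for all but finitely many $n$, $x\mathrel{E}x_{l_n(\vec x,x)}$.
   Formalization: In the definition of non-uniformly BC-learnable, the functions l_n are required to be continuous only in x for each fixed sequence, not jointly on X^ω × X; with joint continuity the equivalence fails, for example for a suitable E on 2^ω × {0,1,2}. *)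

(* Defs.v *)
From HB Require Import structures.
From mathcomp Require Import all_boot all_order all_algebra.
From mathcomp Require Import all_classical all_reals topology.

Set Implicit Arguments.
Unset Strict Implicit.
Unset Printing Implicit Defensive.

Import Order.TTheory GRing.Theory Num.Theory.

Local Open Scope classical_set_scope.
Local Open Scope ring_scope.

Definition is_metric (R : realType) (X : Type) (d : X -> X -> R) : Prop :=
  [/\ forall x y, 0 <= d x y,
      forall x y, d x y = 0 <-> x = y,
      forall x y, d x y = d y x
    & forall x y z, d x z <= d x y + d y z].

Definition metric_induces_topology (R : realType) (X : topologicalType)
    (d : X -> X -> R) : Prop :=
  forall (x : X) (A : set X),
    nbhs x A <-> exists2 e : R, 0 < e & [set y | d x y < e] `<=` A.

Definition cauchy_sequence (R : realType) (X : Type) (d : X -> X -> R)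
    (u : nat -> X) : Prop :=
  forall e : R, 0 < e ->
    exists N : nat, forall m n, (N <= m)%N -> (N <= n)%N -> d (u m) (u n) < e.

Definition complete_metric (R : realType) (X : topologicalType)
    (d : X -> X -> R) : Prop :=
  forall u : nat -> X, cauchy_sequence d u -> exists x : X, u @ \oo --> x.

Definition completely_metrizable (R : realType) (X : topologicalType) : Prop :=
  exists d : X -> X -> R,
    [/\ is_metric d, metric_induces_topology d & complete_metric d].

Definition separable_space (X : topologicalType) : Prop :=
  exists2 S : set X, countable S & dense S.

Definition polish (R : realType) (X : topologicalType) : Prop :=
  separable_space X /\ completely_metrizable R X.

(* [nat] carries the discrete topology of the library. *)
Definition nonuniformly_learnable (X : topologicalType)
    (E : X -> X -> Prop) : Prop :=
  forall xs : nat -> X, exists l : nat -> X -> nat,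
    (forall n, continuous (l n)) /\
    (forall x : X, (exists i, E x (xs i)) ->
       exists L : nat, (fun n => l n x) @ \oo --> L /\ E x (xs L)).

(* Non-uniformity is the absence of any continuity requirement in the sequence
   [xs]: only the sections [l n xs] are continuous. Joint continuity on
   X^nat * X would give the uniform notion, which is strictly stronger: on
   2^nat * {0,1,2}, let [c] range over codes of all sequences of continuous
   learners and glue (c,0) to exactly one of (c,1), (c,2) so that the learner
   coded by [c] fails at (c,0) on the sequence (c,1), (c,2), (c,2), ... *)
Definition nonuniformly_BC_learnable (X : topologicalType)
    (E : X -> X -> Prop) : Prop :=
  exists l : nat -> (nat -> X) -> X -> nat,
    (forall n xs, continuous (l n xs)) /\
    (forall (x : X) (xs : nat -> X), (exists i, E x (xs i)) ->
       \forall n \near \oo, E x (xs (l n xs x))).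

(* Main.v *)
(** If [x] is equivalent to [xs i], then the least index [j] with [xs j]
    equivalent to [xs i] depends only on the class of [x]. Replacing each guess
    of a BC-learner by this least index therefore turns eventual correctness
    into eventual constancy, and continuity survives because the guesses live
    in a discrete space. The converse is a choice of learners, one for each
    sequence. *)

Require Import Defs.
From HB Require Import structures.
From mathcomp Require Import all_boot all_order all_algebra.
From mathcomp Require Import all_classical all_reals topology.

Set Implicit Arguments.
Unset Strict Implicit.
Unset Printing Implicit Defensive.

Local Open Scope classical_set_scope.

Lemma discrete_continuous (D : discreteTopologicalType) (T : topologicalType)
    (r : D -> T) : continuous r.
Proof.
move=> x; apply: (@near_cst_continuous _ _ (r x)).
by apply: filterS (discrete_set1 x) => _ ->.
Qed.

Lemma least_representative (X : Type) (E : X -> X -> Prop)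
    (hE : RelationClasses.Equivalence E) (xs : nat -> X) :
  exists r : nat -> nat,
    (forall i, E (xs i) (xs (r i))) /\
    (forall i j, E (xs i) (xs j) -> r i = r j).
Proof.
have [Erefl Esym Etrans] := hE.
have exr i : exists j, `[< E (xs i) (xs j) >] by exists i; apply/asboolP.
exists (fun i => ex_minn (exr i)); split=> [i|i j Eij].
  by case: ex_minnP => j /asboolP.
(* Both minima range over the same set of indices, by symmetry and transitivity. *)
apply: eq_ex_minn => k; apply/asboolP/asboolP => Ek.
  by apply: Etrans Ek; apply: Esym.
exact: Etrans Ek.
Qed.

Lemma learnable_BC_learnable (X : topologicalType) (E : X -> X -> Prop) :
  nonuniformly_learnable E -> nonuniformly_BC_learnable E.
Proof.
move=> /choice[l lP]; exists (fun n xs => l xs n); split=> [n xs|x xs xi].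
  exact: (lP xs).1.
have [L [lL EL]] := (lP xs).2 x xi.
(* [[set L]] is a neighbourhood of [L], so convergence to [L] means eventual equality. *)
have lnL : \forall n \near \oo, l xs n x = L := lL _ (discrete_set1 L).
by apply: filterS lnL => n ->.
Qed.

Lemma BC_learnable_learnable (X : topologicalType) (E : X -> X -> Prop)
    (hE : RelationClasses.Equivalence E) :
  nonuniformly_BC_learnable E -> nonuniformly_learnable E.
Proof.
move=> [l [lc lE]] xs; have [Erefl Esym Etrans] := hE.
have [r [rE r_eq]] := least_representative hE xs.
exists (fun n => r \o l n xs); split=> [n|x [i Exi]].
  by move=> x; apply: continuous_comp; [exact: lc|exact: discrete_continuous].
(* Eventually the guessed term is equivalent to [x], hence to [xs i], and [r] sends the guess to
   [r i], whichever witness [i] was given. *)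
exists (r i); split; last exact: Etrans (rE i).
apply: cvg_near_cst; have := lE x xs (ex_intro _ i Exi).
by apply: filterS => n En /=; apply: r_eq; apply: Etrans Exi; apply: Esym.
Qed.

Theorem theorem2p4 (R : realType) (X : topologicalType) (hX : polish R X)
    (E : X -> X -> Prop) (hE : RelationClasses.Equivalence E) :
  nonuniformly_learnable E <-> nonuniformly_BC_learnable E.
Proof.
split; first exact: learnable_BC_learnable.
exact: BC_learnable_learnable.
Qed.
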